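(* Let $\Gamma$ be an arbitrary finite quiver of reduced rank one, and let $\Lambda$ be a connected component of $\Gamma$ containing a cycle which is not a loop, with vertices $i_1,\ldots,i_r$ ($r\geq 2$). Let $\Lambda'$ be the quiver obtained from $\Lambda$ by removing the arrows of this cycle (and disregarding loops). Then, for every $k$, the connected component $\Lambda'_k$ of $\Lambda'$ containing $i_k$ is a tree (possibly degenerate, i.e. consisting of the single vertex $i_k$) which is rooted at $i_k$ and canonically oriented, i.e. all its arrows point away from the root $i_k$. Moreover, the trees $\Lambda'_k$ and $\Lambda'_l$ are disjoint for $k\neq l$.
   Context: A quiver $\Gamma$ has a vertex set $\Gamma^0$, an arrow set $\Gamma^1$, and source and target maps $s,t:\Gamma^1\to\Gamma^0$. A cycle is a path of arrows $(\alpha_1,\dots,\alpha_r)$ with $t(\alpha_i)=s(\alpha_{i+1})$ for $i<r$ and $t(\alpha_r)=s(\alpha_1)$, with pairwise distinct vertices $s(\alpha_1),\dots,s(\alpha_r)$; loops are the cycles of length $1$. The reduced rank of a vertex $i$ is $\mathrm{rrank}(i)=\#\{\alpha\in\Gamma^1\mid t(\alpha)=i,\ s(\alpha)\neq i\}$, and the reduced rank of $\Gamma$ is $\max_{i}\mathrm{rrank}(i)$. Connected components are those of the underlying undirected graph, with inherited orientation. A tree is a connected undirected graph without cycles. *)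

(* Defs.v *)
From mathcomp Require Import all_boot.

Set Implicit Arguments.
Unset Strict Implicit.
Unset Printing Implicit Defensive.

Record quiver := Quiver {
  vertex : finType;
  arrow : finType;
  src : arrow -> vertex;
  tgt : arrow -> vertex }.

Definition rrank (G : quiver) (i : vertex G) : nat :=
  #|[set a : arrow G | (tgt a == i) && (src a != i)]|.

Definition reduced_rank (G : quiver) : nat := \max_(i : vertex G) rrank i.

(* Components, and quivers obtained by deleting arrows, are all subquivers of
   the ambient quiver, so that their vertices and arrows share the same types.
   The closure condition is boolean, hence proof-irrelevant: two subquivers
   with the same vertices and arrows are equal. *)
Record subquiver (G : quiver) := Subquiver {
  verts : {set vertex G};
  arrs : {set arrow G};
  arrs_closed :
    [forall a in arrs, (src a \in verts) && (tgt a \in verts)] }.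

Section Subquivers.
Variable G : quiver.
Implicit Types (D : subquiver G) (i j r : vertex G).

Fact full_closed :
  [forall a in [set: arrow G],
     (src a \in [set: vertex G]) && (tgt a \in [set: vertex G])].
Proof. by apply/forall_inP => a _; rewrite !inE. Qed.

Definition full_quiver : subquiver G := Subquiver full_closed.

Fact induced_closed D (W : {set vertex G}) :
  [forall a in [set a in arrs D | (src a \in W) && (tgt a \in W)],
     (src a \in verts D :&: W) && (tgt a \in verts D :&: W)].
Proof.
apply/forall_inP => a; rewrite !inE => /and3P[aD -> ->].
by rewrite !andbT; apply: (forall_inP (arrs_closed D)).
Qed.

Definition induced D (W : {set vertex G}) : subquiver G :=
  Subquiver (induced_closed D W).

Fact remove_arrows_closed D (B : {set arrow G}) :
  [forall a in arrs D :\: B, (src a \in verts D) && (tgt a \in verts D)].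
Proof.
apply/forall_inP => a; rewrite inE => /andP[_ aD].
exact: (forall_inP (arrs_closed D)).
Qed.

Definition remove_arrows D (B : {set arrow G}) : subquiver G :=
  Subquiver (remove_arrows_closed D B).

Definition loops : {set arrow G} := [set a | src a == tgt a].

Definition adjacent D : rel (vertex G) := fun i j =>
  [exists a in arrs D, ((src a == i) && (tgt a == j))
                    || ((src a == j) && (tgt a == i))].

Definition component D i : subquiver G :=
  induced D [set j | connect (adjacent D) i j].

Definition is_component D (E : subquiver G) : Prop :=
  exists2 i, i \in verts D & E = component D i.

Definition is_cycle D (c : seq (arrow G)) : bool :=
  [&& c != [::], all [in arrs D] c,
      cycle (fun a b => tgt a == src b) c & uniq [seq src a | a <- c]].

(* An edge of the underlying undirected multigraph together with a direction
   of traversal: (a, true) runs from src a to tgt a, (a, false) backwards. *)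
Definition dart : Type := (arrow G * bool)%type.
Definition dart_from (x : dart) : vertex G := if x.2 then src x.1 else tgt x.1.
Definition dart_to (x : dart) : vertex G := if x.2 then tgt x.1 else src x.1.

(* Parallel arrows, as well as a pair of opposite arrows, form an undirected
   cycle of length 2; the edges of a cycle have to be distinct since going
   back and forth along a single edge is not a cycle. *)
Definition is_undirected_cycle D (p : seq dart) : bool :=
  [&& p != [::], all (fun x => x.1 \in arrs D) p,
      cycle (fun x y => dart_to x == dart_from y) p,
      uniq [seq dart_from x | x <- p] & uniq [seq x.1 | x <- p]].

Definition is_connected D : Prop :=
  verts D != set0 /\ {in verts D &, forall i j, connect (adjacent D) i j}.

Definition is_tree D : Prop :=
  is_connected D /\ forall p, ~~ is_undirected_cycle D p.

Fixpoint is_undirected_walk D i (p : seq dart) j : bool :=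
  if p is x :: q then
    [&& x.1 \in arrs D, dart_from x == i & is_undirected_walk D (dart_to x) q j]
  else i == j.

(* [n] is the distance from [i] to [j] in the underlying undirected graph. *)
Definition is_dist D i j (n : nat) : Prop :=
  (exists2 p, is_undirected_walk D i p j & size p = n) /\
  (forall p, is_undirected_walk D i p j -> n <= size p).

Definition points_away D r (a : arrow G) : Prop :=
  exists n, is_dist D r (src a) n /\ is_dist D r (tgt a) n.+1.

Definition is_rooted_tree D r : Prop := is_tree D /\ r \in verts D.

Definition canonically_oriented D r : Prop :=
  {in arrs D, forall a, points_away D r a}.

End Subquivers.

(* Main.v *)
Require Import Defs.
From mathcomp Require Import all_boot.

(** Reduced rank one says that a vertex is the target of at most one non-loop
    arrow, and a vertex of the cycle already receives an arrow of the cycle.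
    So in [Lambda'] the map [tgt] is injective on arrows and no arrow enters a
    vertex [i_k]. After a directed path from the root [i_k], a step against an
    arrow can only undo the last arrow of that path; hence every vertex of the
    component ends a directed path from the root, whose length is determined by
    the vertex and is its distance to the root. *)

Set Implicit Arguments.
Unset Strict Implicit.
Unset Printing Implicit Defensive.

Lemma adjacent_sym (G : quiver) (D : subquiver G) : symmetric (adjacent D).
Proof. by move=> i j; apply: eq_existsb => a; rewrite orbC. Qed.

Section Connectivity.
Variables (G : quiver) (D : subquiver G).
Implicit Types (i j : vertex G) (a : arrow G).

Lemma arrow_adjacent a : a \in arrs D -> adjacent D (src a) (tgt a).
Proof. by move=> aD; apply/exists_inP; exists a; rewrite ?eqxx. Qed.

Lemma connect_walk i j :
  connect (adjacent D) i j -> exists p, is_undirected_walk D i p j.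
Proof.
case/connectP => s; elim: s i => [|k s IHs] i /=.
  by move=> _ ->; exists [::] => /=.
case/andP => /exists_inP[a aD ik] ks js.
have [p kpj] := IHs k ks js.
case/orP: ik => /andP[/eqP ai /eqP ak].
  by exists ((a, true) :: p); rewrite /= aD /dart_from /dart_to /= ai ak eqxx.
by exists ((a, false) :: p); rewrite /= aD /dart_from /dart_to /= ai ak eqxx.
Qed.

Lemma is_undirected_walk_rcons i p x :
  is_undirected_walk D i p (dart_from x) -> x.1 \in arrs D ->
  is_undirected_walk D i (rcons p x) (dart_to x).
Proof.
move=> + xD; elim: p i => [|y p IHp] i /= => [/eqP->|/and3P[-> -> /IHp//]].
by rewrite xD !eqxx.
Qed.

(** Every prefix of a path from [i] ends in the component of [i], so the arrow behind each step
    survives the restriction. *)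
Lemma component_connect i j :
  connect (adjacent D) i j -> connect (adjacent (component D i)) i j.
Proof.
case/connectP => s + ->; elim/last_ind: s => [|s k IHs] //=.
rewrite rcons_path last_rcons => /andP[is_ sk].
apply: connect_trans (IHs is_) (connect1 _).
have Ds : connect (adjacent D) i (last i s) by apply/connectP; exists s.
have Dk : connect (adjacent D) i k by apply: connect_trans Ds (connect1 sk).
case/exists_inP: sk => a aD sk; apply/exists_inP; exists a => //.
rewrite !inE aD.
by case/orP: sk => /andP[/eqP-> /eqP->]; rewrite Ds Dk.
Qed.

Lemma component_root i : i \in verts D -> i \in verts (component D i).
Proof. by move=> iD; rewrite !inE iD connect0. Qed.

Lemma component_is_connected i : i \in verts D -> is_connected (component D i).
Proof.
move=> iD; split; first by apply/set0Pn; exists i; apply: component_root.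
move=> j k; rewrite !inE => /andP[_ ij] /andP[_ ik].
apply: connect_trans (component_connect ik).
by rewrite (sym_connect_sym (@adjacent_sym _ _)) component_connect.
Qed.

End Connectivity.

Section Rooted.
Variables (G : quiver) (D : subquiver G) (r : vertex G).
Hypothesis tgt_inj : {in arrs D &, injective (@tgt G)}.
Hypothesis root_in : {in arrs D, forall a, tgt a != r}.
Implicit Types (i j : vertex G) (a : arrow G) (n : nat).

(** Directed paths of length [n] from [r] to [j], unfolded from the end at [j], because there
    [tgt_inj] leaves no choice of arrow. *)
Fixpoint depth n j : bool :=
  if n is n'.+1 then [exists a in arrs D, (tgt a == j) && depth n' (src a)]
  else r == j.

Lemma depth_tgt a n : a \in arrs D -> depth n.+1 (tgt a) = depth n (src a).
Proof.
move=> aD; apply/exists_inP/idP => [[b bD /andP[/eqP ba]]|an].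
  by rewrite (tgt_inj bD aD ba).
by exists a; rewrite ?eqxx.
Qed.

Lemma depth_tgtP a n :
  a \in arrs D -> depth n (tgt a) -> exists2 m, n = m.+1 & depth m (src a).
Proof.
move=> aD; case: n => [/eqP ra|n].
  by have := root_in aD; rewrite -ra eqxx.
by rewrite depth_tgt //; exists n.
Qed.

(** Two directed paths from [r] to [j] share their last arrow and can be shortened together; since
    no arrow enters [r], they run out at the same time. *)
Lemma depth_inj j m n : depth m j -> depth n j -> m = n.
Proof.
elim: m n j => [|m IHm] n j; last first.
  case/exists_inP => a aD /andP[/eqP<- am] /(depth_tgtP aD)[k -> ak].
  by rewrite (IHm _ _ am ak).
case: n => // n /eqP<- /exists_inP[a aD /andP[ar _]].
by have := root_in aD; rewrite ar.
Qed.

(** A forward step raises the depth by one, a backward step lowers it by one. With [n = 0] and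
    [depth_inj], the bound shows that no walk from the root is shorter than the depth of its
    endpoint. *)
Lemma walk_depth i p j n :
  is_undirected_walk D i p j -> depth n i ->
  exists2 m, m <= n + size p & depth m j.
Proof.
elim: p i n => [|[a b] p IHp] i n /=.
  by move/eqP=> ->; exists n; rewrite ?addn0.
rewrite /dart_from /dart_to; case: b => /and3P[aD /eqP<- w] /= an.
  have [|m mn mj] := IHp _ n.+1 w; first by rewrite depth_tgt.
  by exists m; rewrite // addnS.
have [k -> ak] := depth_tgtP aD an.
have [m mk mj] := IHp _ _ w ak.
by exists m => //; apply: leq_trans mk _; rewrite leq_add.
Qed.

Lemma depth_walk n j :
  depth n j -> exists2 p, is_undirected_walk D r p j & size p = n.
Proof.
elim: n j => [|n IHn] j /=; first by exists [::].
case/exists_inP => a aD /andP[/eqP<- /IHn[p w <-]].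
exists (rcons p (a, true)); last by rewrite size_rcons.
exact: (is_undirected_walk_rcons (x := (a, true))).
Qed.

Lemma depth_is_dist n j : depth n j -> is_dist D r j n.
Proof.
move=> nj; split; first exact: depth_walk.
move=> p w; have [m mp mj] := walk_depth w (eqxx r : depth 0 r).
by rewrite (depth_inj nj mj).
Qed.

Lemma connect_depth j : connect (adjacent D) r j -> exists n, depth n j.
Proof.
case/connect_walk => p w.
by have [m _ mj] := walk_depth w (eqxx r : depth 0 r); exists m.
Qed.

(* The arrows of an undirected cycle have distinct targets among its equally
   many vertices, so every vertex of the cycle is entered by one of its arrows
   and one can go up towards the root forever without leaving the cycle. *)
Lemma undirected_cycle_not_depth p x n :
  is_undirected_cycle D p -> x \in p -> ~~ depth n (dart_from x).
Proof.
case/and5P => _ /allP/= pD cp fu au.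
have to_p y : y \in p -> dart_to y \in map (@dart_from G) p.
  by move=> yp; rewrite (eqP (next_cycle cp yp)) map_f ?mem_next.
have src_p y : y \in p -> src y.1 \in map (@dart_from G) p.
  by move=> yp; case: y yp (to_p y yp) (map_f (@dart_from G) yp) => a [].
have tgt_p y : y \in p -> tgt y.1 \in map (@dart_from G) p.
  by move=> yp; case: y yp (to_p y yp) (map_f (@dart_from G) yp) => a [].
pose tgts := [seq tgt a | a <- [seq y.1 | y <- p]].
have tu : uniq tgts.
  rewrite map_inj_in_uniq // => _ _ /mapP[y yp ->] /mapP[z zp ->].
  by apply: tgt_inj; apply: pD.
have sub : {subset tgts <= map (@dart_from G) p}.
  by move=> _ /mapP[_ /mapP[y yp ->] ->]; apply: tgt_p.
have tgtsE : tgts =i map (@dart_from G) p.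
  by case: (uniq_min_size tu sub); rewrite ?size_map.
elim: n x => [|n IHn] x xp; apply/negP; have := map_f (@dart_from G) xp;
  rewrite -tgtsE => /mapP[_ /mapP[y yp ->] ->]; have yD := pD _ yp.
  by case/(depth_tgtP yD).
rewrite depth_tgt //; have /mapP[z zp ->] := src_p _ yp.
exact/negP/IHn.
Qed.

(** Connectedness is assumed only from here on, so that the lemmas above can also be applied to the
    whole of [Lambda'] to prove disjointness. *)
Hypothesis D_connected : is_connected D.
Hypothesis rD : r \in verts D.

Lemma vertex_depth j : j \in verts D -> exists n, depth n j.
Proof. by move=> jD; apply: connect_depth; apply: D_connected.2. Qed.

Lemma connected_is_rooted_tree : is_rooted_tree D r.
Proof.
split=> //; split=> // p; apply/negP => pc.
case: p pc => [|x p] pc; first by case/and5P: pc.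
have /and5P[_ /= /andP[xD _] _ _ _] := pc.
have [|n] := @vertex_depth (dart_from x).
  have /andP[sD tD] := forall_inP (arrs_closed D) _ xD.
  by rewrite /dart_from; case: ifP.
by apply/negP/(undirected_cycle_not_depth _ pc); rewrite mem_head.
Qed.

Lemma connected_canonically_oriented : canonically_oriented D r.
Proof.
move=> a aD; have /andP[sD _] := forall_inP (arrs_closed D) _ aD.
have [n an] := vertex_depth sD; exists n.
by split; apply: depth_is_dist; rewrite ?depth_tgt.
Qed.

End Rooted.

Lemma reduced_rank1_tgt_inj (G : quiver) (a b : arrow G) :
  reduced_rank G <= 1 -> a \notin loops G -> b \notin loops G ->
  tgt a = tgt b -> a = b.
Proof.
rewrite !inE => G1 al bl ab.
have /card_le1_eqP : rrank (tgt a) <= 1 := leq_trans (leq_bigmax _) G1.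
by apply; rewrite inE ?ab eqxx // -ab.
Qed.

(** Rotate [a] to the front: as the length is at least two, another arrow of the cycle starts at
    [tgt a], and sources along a cycle are distinct. *)
Lemma is_cycle_not_loop (G : quiver) (D : subquiver G) (c : seq (arrow G)) a :
  is_cycle D c -> 2 <= size c -> a \in c -> a \notin loops G.
Proof.
case/and4P => _ _ cc cu c2 /rot_to[n s cE].
move: cc cu c2; rewrite -(rot_cycle n) -(rot_uniq n) -map_rot -(size_rot n) cE.
case: s {cE} => [|b s] //= /andP[/eqP ab _] /andP[+ _] _.
by rewrite !inE ab; case: eqP.
Qed.

Theorem proposition2p5 (Gamma : quiver) (hGamma : reduced_rank Gamma = 1)
    (Lambda : subquiver Gamma)
    (hLambda : is_component (full_quiver Gamma) Lambda)
    (r : nat) (hr : 2 <= r) (c : r.-tuple (arrow Gamma))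
    (hc : is_cycle Lambda c) :
  let Lambda' :=
    remove_arrows (remove_arrows Lambda [set a in c]) (loops Gamma) in
  let T := fun k : 'I_r => component Lambda' (src (tnth c k)) in
  (forall k : 'I_r,
     is_rooted_tree (T k) (src (tnth c k)) /\
     canonically_oriented (T k) (src (tnth c k))) /\
  (forall k l : 'I_r, k != l -> [disjoint verts (T k) & verts (T l)]).
Proof.
move=> L' T.
have L'P a : a \in arrs L' -> a \notin loops Gamma /\ a \notin c.
  by rewrite !inE => /and3P[].
have tgt_inj : {in arrs L' &, injective (@tgt Gamma)}.
  move=> a b /L'P[al _] /L'P[bl _].
  by apply: reduced_rank1_tgt_inj; rewrite ?hGamma.
have c2 : 2 <= size c by rewrite size_tuple.
have /and4P[_ /allP cD cc cu] := hc.
(* A non-loop arrow into a vertex of the cycle must be the cycle arrow ending there, and that one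
   has been removed. *)
have root_in k : {in arrs L', forall a, tgt a != src (tnth c k)}.
  move=> a /L'P[al ac]; apply: contra ac => /eqP ak.
  have pc : prev c (tnth c k) \in c by rewrite mem_prev mem_tnth.
  suff -> : a = prev c (tnth c k) by [].
  apply: reduced_rank1_tgt_inj; rewrite ?hGamma //.
    exact: is_cycle_not_loop hc c2 pc.
  by rewrite ak (eqP (prev_cycle cc (mem_tnth k c))).
split=> [k | k l kl].
  have kL' : src (tnth c k) \in verts L'.
    by have /andP[] := forall_inP (arrs_closed Lambda) _ (cD _ (mem_tnth k c)).
  have sub : {subset arrs (T k) <= arrs L'} by move=> a; rewrite inE => /andP[].
  have tgt_injT := sub_in2 sub tgt_inj.
  have root_inT := sub_in1 sub (root_in k).
  have Tc := component_is_connected kL'; have Tr := component_root kL'.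
  split; first exact: connected_is_rooted_tree.
  exact: connected_canonically_oriented.
apply/pred0P => j; apply/negP => /=.
rewrite !inE => /andP[/andP[_ kj] /andP[_ lj]].
(* A common vertex connects the two roots, so the second has a depth relative to the first. Depth
   zero contradicts the distinctness of the sources; positive depth gives an arrow of [L'] entering
   the second root. *)
have : connect (adjacent L') (src (tnth c k)) (src (tnth c l)).
  by apply: connect_trans kj _; rewrite (sym_connect_sym (@adjacent_sym _ _)).
case/(connect_depth tgt_inj (root_in k)) => -[/eqP|n /exists_inP[a aL']].
  have /tuple_uniqP src_inj : uniq (map_tuple (@src Gamma) c) := cu.
  by move=> kl_src; case/eqP: kl; apply: src_inj; rewrite !tnth_map.
by rewrite (negPf (root_in l a aL')).
Qed.
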